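(* Let $X$ be a separable metric space and let $\varphi:\mathcal{P}(\omega)\to[0,\infty]$ be a lower semicontinuous submeasure such that $\|\omega\|_\varphi=1$. Then $\nu:=\|\cdot\|_\varphi$ is a diffuse submeasure which satisfies the following condition: for every $\alpha\in(0,1)$ there exists a function $g_\alpha:\omega\to\omega$ such that for every $A\subseteq\omega$ with $\nu(\omega\setminus A)\le 1-\alpha$ there exists $n_{\alpha,A}\in\omega$ such that $A\cap[n,n+g_\alpha(n)]\neq\emptyset$ for all $n\ge n_{\alpha,A}$. Hence, the set $\Sigma_{\|\cdot\|_\varphi}(X)$ of $\|\cdot\|_\varphi$-maldistributed sequences is comeager in $X^\omega$.
   Context: $\omega$ is the set of nonnegative integers; intervals such as $[n,m]$ denote intervals of integers in $\omega$. A lower semicontinuous submeasure is a map $\varphi:\mathcal{P}(\omega)\to[0,\infty]$ with $\varphi(\emptyset)=0$ which is monotone ($\varphi(A)\le\varphi(B)$ for $A\subseteq B\subseteq\omega$), subadditive ($\varphi(A\cup B)\le\varphi(A)+\varphi(B)$ for all $A,B\subseteq\omega$), satisfies $\varphi(F)<\infty$ for all finite $F\subseteq\omega$, and satisfies $\varphi(A)=\sup\{\varphi(A\cap[0,n]):n\in\omega\}$ for all $A\subseteq\omega$. For $S\subseteq\omega$ set $\|S\|_\varphi:=\lim_{n\to\infty}\varphi(S\setminus[0,n])$. A diffuse submeasure is a map $\nu:\mathcal{P}(\omega)\to\mathbb{R}$ that is monotone, subadditive, and satisfies $\nu(F)=0$ and $\nu(\omega\setminus F)=1$ for all finite $F\subseteq\omega$.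 Given a topological space $X$ and such a $\nu$, a sequence $\mathbf{x}=(x_n:n\in\omega)\in X^\omega$ is $\nu$-maldistributed if $\nu(\{n\in\omega:x_n\in U\})=1$ for all nonempty open sets $U\subseteq X$. Define $\Sigma_\nu(X):=\{\mathbf{x}\in X^\omega:\mathbf{x}\text{ is }\nu\text{-maldistributed}\}$, where $X^\omega$ carries the product topology. A set is meager if it is contained in a countable union of closed sets with empty interior, and comeager if its complement is meager. *)

(* Defs.v *)
From HB Require Import structures.
From mathcomp Require Import all_boot all_order all_algebra.
From mathcomp Require Import all_classical all_reals all_analysis.

Set Implicit Arguments.
Unset Strict Implicit.
Unset Printing Implicit Defensive.

Import Order.TTheory GRing.Theory Num.Theory.

Local Open Scope classical_set_scope.
Local Open Scope ring_scope.

Definition nat_itv (n m : nat) : set nat := [set k | (n <= k <= m)%N].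

Record lsc_submeasure (R : realType) (phi : set nat -> \bar R) : Prop :=
  LscSubmeasure {
    lsc_ge0 : forall A, (0 <= phi A)%E ;
    lsc_set0 : phi set0 = 0%E ;
    lsc_mono : forall A B, A `<=` B -> (phi A <= phi B)%E ;
    lsc_subadd : forall A B, (phi (A `|` B) <= phi A + phi B)%E ;
    lsc_fin : forall F, finite_set F -> (phi F < +oo)%E ;
    lsc_sup : forall A,
      phi A = ereal_sup (range (fun n => phi (A `&` nat_itv 0 n)))
  }.

(* For a monotone [phi] the sequence is nonincreasing, so it converges in
   [\bar R] and [limn] is its actual limit, not a default value. *)
Definition submeasure_norm (R : realType) (phi : set nat -> \bar R)
    (S : set nat) : \bar R :=
  limn (fun n => phi (S `\` nat_itv 0 n)).

Record diffuse_submeasure (R : realType) (nu : set nat -> R) : Prop :=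
  DiffuseSubmeasure {
    diffuse_mono : forall A B, A `<=` B -> nu A <= nu B ;
    diffuse_subadd : forall A B, nu (A `|` B) <= nu A + nu B ;
    diffuse_finite : forall F, finite_set F -> nu F = 0 ;
    diffuse_cofinite : forall F, finite_set F -> nu (~` F) = 1
  }.

Definition maldistributed (R : realType) (X : topologicalType)
    (nu : set nat -> R) (x : nat -> X) : Prop :=
  forall U : set X, open U -> U !=set0 -> nu [set n | U (x n)] = 1.

(* The codomain is a set in [prod_topology], so that [X^omega] carries the
   product topology and not the uniform one of plain arrow types. *)
Definition Sigma (R : realType) (X : topologicalType) (nu : set nat -> R) :
    set (prod_topology (fun _ : nat => X)) :=
  [set x | maldistributed nu x].
Arguments Sigma {R} X nu.

Definition separable (T : topologicalType) : Prop :=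
  exists2 D : set T, countable D & dense D.

Definition meager (T : topologicalType) (A : set T) : Prop :=
  exists2 F : (set T)^nat,
    (forall i, closed (F i) /\ interior (F i) = set0) & A `<=` \bigcup_i F i.

Definition comeager (T : topologicalType) (A : set T) : Prop := meager (~` A).

(* Main.v *)
(** The tails [phi (S \ [0, n])] decrease to the norm of [S], so the cofinite
    tails of omega all have measure at least 1, and lower semicontinuity makes
    a finite window [[n, n + g n]] of such a tail have measure greater than
    [1 - alpha / 2]; a set [A] missing infinitely many of these windows has a
    complement of norm greater than [1 - alpha].  For comeagerness, a sequence
    [x] is maldistributed as soon as, for every [j] and every nonempty [U] in a
    countable basis, [{i > j | x i \in U}] has measure greater than
    [1 - 1 / (j + 1)].  By lower semicontinuity this depends on finitely many
    coordinates, hence is an open condition; it is dense since any sequence is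
    the limit of sequences that are eventually constant with value in [U]. *)

Require Import Defs.
From HB Require Import structures.
From mathcomp Require Import all_boot all_order all_algebra.
From mathcomp Require Import all_classical all_reals all_analysis.

Set Implicit Arguments.
Unset Strict Implicit.
Unset Printing Implicit Defensive.

Import Order.TTheory GRing.Theory Num.Theory.

Local Open Scope classical_set_scope.
Local Open Scope ring_scope.

(** * Initial segments of omega *)

Lemma subset_nat_itv0 (n m : nat) : (n <= m)%N -> nat_itv 0 n `<=` nat_itv 0 m.
Proof. by move=> nm k /= /leq_trans; apply. Qed.

Lemma not_nat_itv0P (n k : nat) : ~ nat_itv 0 n k <-> (n < k)%N.
Proof. by rewrite ltnNge; split=> /negP. Qed.

Lemma finite_subset_nat_itv (F : set nat) :
  finite_set F -> exists n, F `<=` nat_itv 0 n.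
Proof.
move=> /finite_seqP[s ->]; exists (\max_(i <- s) i)%N => k /= ks.
exact: (@leq_bigmax_seq _ _ predT id).
Qed.

(** * The norm of a lower semicontinuous submeasure *)

Section LscSubmeasure.
Context {R : realType} {phi : set nat -> \bar R} (phi_lsc : lsc_submeasure phi).

Lemma lsc_submeasure_gt (A : set nat) (c : \bar R) :
  (c < phi A)%E -> exists m, (c < phi (A `&` nat_itv 0 m))%E.
Proof.
by rewrite (lsc_sup phi_lsc A) => /ereal_sup_gt[_ [m _ <-]]; exists m.
Qed.

Lemma submeasure_tail_nonincreasing (S : set nat) :
  nonincreasing_seq (fun n => phi (S `\` nat_itv 0 n)).
Proof.
by move=> n m nm; exact: (lsc_mono phi_lsc) (setDS (subset_nat_itv0 nm)).
Qed.

(** The tails are nonincreasing, so their limit is their infimum. *)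
Lemma submeasure_normE (S : set nat) :
  submeasure_norm phi S =
  ereal_inf (range (fun n => phi (S `\` nat_itv 0 n))).
Proof.
apply/cvg_lim => //.
exact/ereal_nonincreasing_cvgn/submeasure_tail_nonincreasing.
Qed.

Lemma submeasure_norm_le_tail (S : set nat) (n : nat) :
  (submeasure_norm phi S <= phi (S `\` nat_itv 0 n))%E.
Proof. by rewrite submeasure_normE; apply: ereal_inf_lbound; exists n. Qed.

Lemma submeasure_norm_lt (S : set nat) (c : \bar R) :
  (submeasure_norm phi S < c)%E ->
  exists n, (phi (S `\` nat_itv 0 n) < c)%E.
Proof. by rewrite submeasure_normE => /ereal_inf_lt[_ [n _ <-]]; exists n. Qed.

Lemma submeasure_norm_ge0 (S : set nat) : (0 <= submeasure_norm phi S)%E.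
Proof.
by rewrite submeasure_normE; apply/ereal_infP => _ [n _ <-]; exact: lsc_ge0.
Qed.

Lemma le_submeasure_norm (A B : set nat) :
  A `<=` B -> (submeasure_norm phi A <= submeasure_norm phi B)%E.
Proof.
move=> AB; rewrite [leRHS]submeasure_normE; apply/ereal_infP => _ [n _ <-].
apply: le_trans (submeasure_norm_le_tail A n) _.
exact: (lsc_mono phi_lsc) (setSD AB).
Qed.

Lemma submeasure_norm_subadd (A B : set nat) :
  (submeasure_norm phi (A `|` B) <=
   submeasure_norm phi A + submeasure_norm phi B)%E.
Proof.
have cvg_tail S :=
  ereal_nonincreasing_is_cvgn (@submeasure_tail_nonincreasing S).
(* Nonnegativity excludes an indeterminate sum of infinities, so the limit of the sum may be
   split. *)
have pos_sum : (submeasure_norm phi A +? submeasure_norm phi B)%E.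
  by apply: ge0_adde_def; rewrite inE submeasure_norm_ge0.
rewrite /submeasure_norm -limeD //; apply: lee_lim => //.
  exact: is_cvgeD.
by apply: nearW => n; rewrite setDUl; exact: lsc_subadd.
Qed.

Lemma submeasure_norm_finite (F : set nat) :
  finite_set F -> submeasure_norm phi F = 0%E.
Proof.
move=> /finite_subset_nat_itv[n Fn]; apply/eqP.
rewrite eq_le submeasure_norm_ge0 andbT.
apply: le_trans (submeasure_norm_le_tail F n) _.
have -> : F `\` nat_itv 0 n = set0 by rewrite setD_eq0.
by rewrite (lsc_set0 phi_lsc).
Qed.

Context (phi_norm : submeasure_norm phi setT = 1%E).

Lemma submeasure_norm_le1 (S : set nat) : (submeasure_norm phi S <= 1)%E.
Proof. by rewrite -phi_norm; exact: le_submeasure_norm. Qed.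

(** The norm lies between 0 and 1, so [fine] never returns its default value on it. *)
Lemma submeasure_norm_fin_num (S : set nat) :
  submeasure_norm phi S \is a fin_num.
Proof.
rewrite fin_numE -ltNye -ltey.
by rewrite (lt_le_trans _ (submeasure_norm_ge0 S)) ?ltNy0 //
  (le_lt_trans (submeasure_norm_le1 S)) ?ltry.
Qed.

Lemma submeasure_norm_diffuse :
  diffuse_submeasure (fun S => fine (submeasure_norm phi S)).
Proof.
split=> [A B AB|A B|F finF|F finF].
- by rewrite fine_le ?submeasure_norm_fin_num // le_submeasure_norm.
- rewrite -fineD ?submeasure_norm_fin_num // fine_le ?submeasure_norm_subadd //.
    exact: submeasure_norm_fin_num.
  by rewrite fin_numD !submeasure_norm_fin_num.
- by rewrite submeasure_norm_finite.
- suff -> : submeasure_norm phi (~` F) = 1%E by [].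
  (* Lower bound: omega is the union of [F], of norm 0, and its complement. *)
  apply/eqP; rewrite eq_le submeasure_norm_le1 -phi_norm -(setUv F).
  apply: le_trans (submeasure_norm_subadd _ _) _.
  by rewrite submeasure_norm_finite // add0e.
Qed.

(** * Finite windows met by every set with small complement *)

Lemma submeasure_norm_syndetic (alpha : R) : 0 < alpha ->
  exists g : nat -> nat, forall A : set nat,
    fine (submeasure_norm phi (~` A)) <= 1 - alpha ->
    exists n0 : nat, forall n : nat, (n0 <= n)%N ->
      A `&` nat_itv n (n + g n) !=set0.
Proof.
move=> alpha0.
(* For [n > 0] the difference is the tail [[n, oo[]; only [n > n0] is used. *)
have window n : exists m,
    ((1 - alpha / 2)%:E < phi ((setT `\` nat_itv 0 n.-1) `&` nat_itv 0 m))%E.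
  apply: lsc_submeasure_gt.
  apply: lt_le_trans (submeasure_norm_le_tail _ _).
  by rewrite phi_norm lte_fin gtrDl oppr_lt0 divr_gt0.
have [g gP] := choice window.
exists g => A; rewrite -lee_fin fineK ?submeasure_norm_fin_num // => nuA.
(* Halving [alpha] leaves the strict gap needed to pass from the norm to a tail. *)
have /submeasure_norm_lt[n0 phin0] :
    (submeasure_norm phi (~` A) < (1 - alpha / 2)%:E)%E.
  apply: le_lt_trans nuA _; rewrite lte_fin ltrD2l ltrN2.
  by rewrite ltr_pdivrMr // ltr_pMr // ltr1n.
exists n0.+1 => n n0n; apply/set0P/eqP => An.
have := lt_trans phin0 (gP n); apply/negP; rewrite -leNgt.
apply: (lsc_mono phi_lsc) => k [[_ /not_nat_itv0P nk] kg].
have {}nk : (n <= k)%N by move: nk; rewrite -ltnS prednK // (leq_trans _ n0n).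
split=> [Ak|]; last exact/not_nat_itv0P/(leq_trans n0n nk).
suff: (A `&` nat_itv n (n + g n)) k by rewrite An.
by split=> //; rewrite /nat_itv /= nk (leq_trans kg) ?leq_addl.
Qed.

(** * Open dense conditions on sequences *)

Lemma open_submeasure_gt (X : topologicalType) (U : set X) (K : set nat)
    (c : \bar R) : open U ->
  open [set x : prod_topology (fun _ : nat => X) |
         (c < phi ([set i | U (x i)] `\` K))%E].
Proof.
move=> oU; rewrite openE => x /= /lsc_submeasure_gt[m cm].
pose P := prod_topology (fun _ : nat => X).
have filter_x : Filter (nbhs (x : P)) := nbhs_filter _.
(* The implication asks nothing of coordinates outside [U], and only the coordinates up to [m] are
   constrained. *)
have near_x (i : 'I_m.+1) : nbhs (x : P) [set y : P | U (x i) -> U (y i)].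
  have [Ux|nUx] := pselect (U (x i)); last first.
    by apply: (@filterS _ _ filter_x setT _ _ filterT) => y _ /nUx.
  have cvg_i := @proj_continuous _ (fun _ : nat => X) i x.
  apply: (@filterS _ _ filter_x _ _ _ (cvg_i U (open_nbhs_nbhs (conj oU Ux)))).
  by move=> y Uy _.
apply: (@filterS _ _ filter_x _ _ _ (filter_forall filter_x near_x)) => y xy.
apply: lt_le_trans cm _.
apply: (lsc_mono phi_lsc) => i [[/= Ui Ki] /= im]; split=> //=.
exact: (xy (Ordinal (im : (i < m.+1)%N))).
Qed.

Lemma dense_submeasure_gt (X : topologicalType) (U : set X) (n : nat)
    (c : \bar R) : U !=set0 -> (c < 1)%E ->
  dense [set x : prod_topology (fun _ : nat => X) |
         (c < phi ([set i | U (x i)] `\` nat_itv 0 n))%E].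
Proof.
move=> [u Uu] c1 W [x Wx] oW.
pose y (N : nat) : prod_topology (fun _ : nat => X) :=
  fun i => if (i <= N)%N then x i else u.
have yx : y @ \oo --> (x : prod_topology (fun _ : nat => X)).
  (* Convergence is coordinatewise, and coordinate [i] of [y N] equals [x i] once [N] reaches
     [i]. *)
  apply/cvg_sup => i V [_ [[B _ <-] Bx] BV].
  by apply: filterS BV _; exists i => // N /= iN; rewrite /y iN.
have [N _ WN] := yx W (open_nbhs_nbhs (conj oW Wx)).
(* [N] secures membership in [W]; [n] places the constant part beyond [[0, n]]. *)
exists (y (maxn n N)); split; first exact/WN/leq_maxr.
rewrite /= (lt_le_trans c1) // -phi_norm.
apply: le_trans (submeasure_norm_le_tail _ (maxn n N)) _.
apply: (lsc_mono phi_lsc) => i [_ /not_nat_itv0P ni]; split=> /=.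
  by rewrite /y leqNgt ni.
by apply/not_nat_itv0P; rewrite (leq_ltn_trans _ ni) ?leq_maxl.
Qed.

End LscSubmeasure.

(** * Countable bases and meager sets *)

Lemma separable_second_countable {R : realType} (X : pseudoMetricType R) :
  separable X -> @second_countable X.
Proof.
move=> [D ctD denseD].
(* Interiors are taken because balls of a pseudometric structure need not be open. *)
pose f (n : nat) (d : X) := (ball d (n.+1%:R^-1 : R))°.
exists (\bigcup_n f n @` D); [|split].
- apply: bigcup_countable => // n _.
  exact: sub_countable (card_image_le _ _) ctD.
- by move=> _ [n _ [d _ <-]]; exact: open_interior.
- move=> x V /nbhs_ballP[e /= e0 xeV].
  have [|n] := @ltr_add_invr R 0 (e / 2); first by rewrite divr_gt0.
  rewrite add0r => ne.
  (* Half the radius puts a whole ball around [x] inside the ball at [d], so [x] is interior to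
     it. *)
  have [|d [xd Dd]] := denseD (ball x (n.+1%:R^-1 / 2))° _ (open_interior _).
    by exists x; apply: nbhsx_ballx; rewrite divr_gt0.
  have {}xd := interior_subset xd.
  exists (f n d); first split.
  + by exists n => //; exists d.
  + apply: filterS (nbhsx_ballx x (n.+1%:R^-1 / 2) _).
      by move=> z xz; apply: ball_split xz; exact: ball_sym.
    by rewrite divr_gt0.
  + move=> z /interior_subset dz; apply/xeV/(@ball_split _ _ d).
      apply: le_ball xd; apply: le_trans (ltW ne).
      by rewrite ler_pdivrMr // ler_pMr // ler1n.
    exact: le_ball (ltW ne) _ dz.
Qed.

Lemma meager_bigcup {T : topologicalType} {I : Type} (D : set I)
    (F : I -> set T) : countable D ->
  (forall i, D i -> closed (F i) /\ interior (F i) = set0) ->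
  meager (\bigcup_(i in D) F i).
Proof.
(* Either [D] is empty or it is enumerated by a surjection from [nat]. *)
move=> /pfcard_geP[->|/unsquash f] FD.
  exists (fun=> set0) => [_|].
    by split; [exact: closed0|exact: interior0].
  by rewrite bigcup_set0.
exists (F \o f) => [n|x [i Di Fix]]; first exact/FD/funS.
by have [n _ fn] := @surj _ _ _ _ f _ Di; exists n => //=; rewrite fn.
Qed.

(** Every nonempty open set contains a nonempty basic one; the upper bound 1 is automatic for a
    diffuse submeasure. *)
Lemma maldistributed_basis {R : realType} (X : topologicalType)
    (B : set (set X)) (nu : set nat -> R) (x : nat -> X) :
  basis B -> diffuse_submeasure nu ->
  (forall U, B U -> U !=set0 -> 1 <= nu [set n | U (x n)]) ->
  maldistributed nu x.
Proof.
move=> [_ nbhsB] nuD nuB V oV [p Vp].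
have [U [BU Up] UV] := nbhsB p V (open_nbhs_nbhs (conj oV Vp)).
apply/eqP; rewrite eq_le; apply/andP; split.
  rewrite -(diffuse_cofinite nuD (finite_set0 _)) setC0.
  exact: (diffuse_mono nuD).
apply: le_trans (nuB U BU _) _; first by exists p.
by apply: (diffuse_mono nuD) => n; exact: UV.
Qed.

Lemma interior_setC_dense (T : topologicalType) (A : set T) :
  dense A -> interior (~` A) = set0.
Proof.
move=> dA; apply/eqP/negPn/negP => /set0P/dA/(_ (open_interior _))[x].
by move=> [/interior_subset].
Qed.

Lemma comeager_Sigma {R : realType} (X : topologicalType)
    (phi : set nat -> \bar R) : @second_countable X ->
  lsc_submeasure phi -> submeasure_norm phi setT = 1%E ->
  comeager (Sigma X (fun S => fine (submeasure_norm phi S))).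
Proof.
move=> [B ctB basisB] phi_lsc phi_norm.
(* One index sets both the start of the tail and the tolerance. *)
pose G (p : set X * nat) := [set x : prod_topology (fun _ : nat => X) |
  ((1 - p.2.+1%:R^-1)%:E < phi ([set i | p.1 (x i)] `\` nat_itv 0 p.2))%E].
pose D := [set U | B U /\ U !=set0] `*` [set: nat].
have [F FP AF] : meager (\bigcup_(p in D) ~` G p).
  apply: meager_bigcup.
    apply: countableX (countableP _).
    by apply: sub_countable ctB; apply: subset_card_le => U [].
  move=> [U n] [[/= BU U0] _]; split.
    exact/open_closedC/(open_submeasure_gt phi_lsc)/basisB.1.
  apply/interior_setC_dense/(dense_submeasure_gt phi_lsc phi_norm) => //.
  by rewrite lte_fin gtrDl oppr_lt0 invr_gt0.
exists F => //; apply: subset_trans AF; rewrite -setC_bigcap; apply: subsetC.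
move=> x Gx; apply: maldistributed_basis basisB _ _.
  exact: submeasure_norm_diffuse.
move=> U BU U0; rewrite -lee_fin fineK ?(submeasure_norm_fin_num phi_lsc) //.
rewrite leNgt; apply/negP.
rewrite -(fineK (submeasure_norm_fin_num phi_lsc phi_norm _)) lte_fin.
(* A norm below 1 is below [1 - 1 / (k + 1)] for some [k], hence so is some tail. *)
move=> /ltr_add_invr[k]; rewrite -ltrBrDr -lte_fin.
rewrite fineK ?(submeasure_norm_fin_num phi_lsc) //.
move=> /(submeasure_norm_lt phi_lsc)[n]; apply/negP; rewrite -leNgt ltW //.
(* The maximum gives a tolerance within that of [k] and a tail inside the one past [n], a
   contradiction. *)
have Gxnk : G (U, maxn n k) x by apply: Gx.
apply: (@le_lt_trans _ _ (1 - (maxn n k).+1%:R^-1)%:E).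
  by rewrite lee_fin lerD2l lerN2 lef_pV2 ?posrE // ler_nat ltnS leq_maxr.
apply: lt_le_trans Gxnk _.
exact/(submeasure_tail_nonincreasing phi_lsc)/leq_maxl.
Qed.

Theorem proposition1p3 (R : realType) (X : metricType R)
    (phi : set nat -> \bar R) (sepX : separable X)
    (phi_lsc : lsc_submeasure phi)
    (phi_norm : submeasure_norm phi setT = 1%E) :
  (forall S : set nat, submeasure_norm phi S \is a fin_num) /\
  let nu := fun S : set nat => fine (submeasure_norm phi S) in
  [/\ diffuse_submeasure nu,
      forall alpha : R, 0 < alpha < 1 ->
        exists g : nat -> nat, forall A : set nat, nu (~` A) <= 1 - alpha ->
          exists n0 : nat, forall n : nat, (n0 <= n)%N ->
            A `&` nat_itv n (n + g n) !=set0
    & comeager (Sigma X nu)].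
Proof.
split=> [|nu]; first exact: submeasure_norm_fin_num.
split.
- exact: submeasure_norm_diffuse.
- by move=> alpha /andP[alpha0 _]; exact: submeasure_norm_syndetic.
- exact/comeager_Sigma/phi_norm/phi_lsc/separable_second_countable.
Qed.
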